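(* Fix $q\in[2,\infty]$ and an integer $n\ge 1$. Let $Y_1,\ldots,Y_n$ be i.i.d. real random variables with density proportional to $e^{-|x|^q}$. Then for every unit vector $(a_1,\ldots,a_n)\in\mathbb{R}^n$ (i.e. $\sum_{i=1}^n a_i^2=1$) and every $p\ge 2$, $$\|Y_1\|_p\le\Big\|\sum_{i=1}^n a_iY_i\Big\|_p,$$ whereas for every $p\in[1,2]$ the reverse inequality $$\Big\|\sum_{i=1}^n a_iY_i\Big\|_p\le\|Y_1\|_p$$ holds. These inequalities are sharp (the constant $1$ cannot be improved).
   Context: For a real random variable $S$ and $r>0$, $\|S\|_r=(\mathbb{E}|S|^r)^{1/r}$. For $q=\infty$, ''density proportional to $e^{-|x|^q}$'' means the uniform distribution on $[-1,1]$. *)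

(* Defs.v *)
From mathcomp Require Import all_boot all_order all_algebra.
From mathcomp Require Import all_classical all_reals all_analysis.

Set Implicit Arguments.
Unset Strict Implicit.
Unset Printing Implicit Defensive.

Import Order.TTheory GRing.Theory Num.Theory.
Import numFieldNormedType.Exports.

Local Open Scope classical_set_scope.
Local Open Scope ring_scope.

(* The weight [exp (- |x| ^ q)], not normalized when [q] is finite; for
   [q = +oo] it is by convention the density of the uniform law on [-1, 1].
   The value at [q = -oo] is junk. *)
Definition exp_weight (R : realType) (q : \bar R) (x : R) : R :=
  match q with
  | EFin r => expR (- (`|x| `^ r))
  | +oo%E => uniform_pdf (-1) 1 x
  | -oo%E => 0
  end.

(* The normalizing constant [c] is determined by [g], since [X] has a
   probability law. *)
Definition has_density_proportional_to d (T : measurableType d)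
    (R : realType) (P : probability T R) (X : {RV P >-> R}) (g : R -> R) :=
  exists2 c : R, 0 < c &
    forall A : set R, measurable A ->
      distribution P X A = (\int[lebesgue_measure]_(x in A) (c * g x)%:E)%E.

Definition mutually_independent d (T : measurableType d) (R : realType)
    (P : probability T R) (I : finType) (X : I -> {RV P >-> R}) :=
  forall (J : {set I}) (A : I -> set R), (forall i, measurable (A i)) ->
    P (\bigcap_(i in [set` J]) (X i @^-1` A i)) =
    (\prod_(i in J) P (X i @^-1` A i))%E.

(* Main.v *)
Require Import Defs.
From HB Require Import structures.
From mathcomp Require Import all_boot all_order all_algebra.
From mathcomp Require Import all_classical all_reals all_analysis.
From mathcomp Require Import measurable_realfun ring lra.

Set Implicit Arguments.
Unset Strict Implicit.
Unset Printing Implicit Defensive.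

Import Order.TTheory GRing.Theory Num.Theory.
Import numFieldNormedType.Exports.

Local Open Scope ring_scope.

(** Let [f] be the common density. Two facts about [f] matter: it is even and
    nonincreasing in [|x|], and on every circle [y1^2 + y2^2 = r^2] the product
    [f y1 * f y2] decreases as [max |y1| |y2|] grows; for finite [q] the
    second one says that [|x|^q] is a convex function of [x^2], that is
    [q >= 2].

    Two variables. Let [h] be even and convex as a function of [x^2], and let
    [c^2 + s^2 = 1]. The reflection [sigma] of the plane that maps the first
    basis vector to [(c, s)] preserves area, so [E h (c Y1 + s Y2)] is the
    integral of [h ((sigma y).1)] against [F y := f y1 * f y2]. By the
    symmetries of [F], the function [h] of the first coordinate may be replaced
    by [H y := h y1 + h y2]. On a circle [H] increases and [F] decreases with
    [max |y1| |y2|], so [(H y - H (sigma y)) * (F y - F (sigma y)) <= 0]; since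
    [sigma] is an involution, integrating this inequality gives
    [E h (Y1) <= E h (c Y1 + s Y2)]. This is [rotation_extremal].

    Many variables. To peel off one summand at a time, one averages the test
    function over it: [h] becomes [T_a h x := E h (x + a Y)]. Convexity in [x^2]
    is not preserved by [T_a], but a stronger property is, namely that
    [h (u + v) + h (u - v)] has nonnegative mixed differences in
    [u, v >= 0] (for smooth [h]: [h''] is nondecreasing in [|x|]). It passes to
    [T_a h] by a one-dimensional reflection argument that uses only that [f] is
    even and unimodal ([test_function_average]), and it implies convexity in
    [x^2] ([square_convex]). The power [|x|^p] has this property for [p >= 2],
    and the opposite one for [1 <= p <= 2] ([mixed_monotone_normpow]). As
    [E h (a1 Y1 + ... + an Yn) = T_a1 (... (T_an h)) 0], induction reduces the
    theorem to the two-variable inequality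
    [T_(sqrt (r^2 + a^2)) h 0 <= T_r (T_a h) 0] ([average_average]).

    Sharpness is seen on the first coordinate vector, the norm of [Y1] being
    finite and nonzero. *)

(** * Functions convex in the square of the variable *)

(** Local boundedness from above replaces continuity. The excess [H] of [G]
    over its chord is midpoint convex and vanishes at both endpoints; pairing
    [x] with the nearer endpoint and its mirror image gives
    [H x <= sup H / 2], hence [sup H <= 0]. *)
Lemma midpoint_convex_star {R : realType} (G : R -> R) :
    G 0 = 0 ->
    (forall w d, 0 <= d <= w -> 2 * G w <= G (w + d) + G (w - d)) ->
    (forall u, exists B, forall x, 0 <= x <= u -> G x <= B) ->
  forall u u', 0 <= u <= u' -> u' * G u <= u * G u'.
Proof.
move=> G0 Gmid Gbd u u' /andP[u0 uu'].
pose H x := u' * G x - x * G u'.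
have [B HB] := Gbd u'.
pose E := [set H x | x in [set x | 0 <= x <= u']]%classic.
have u'0 : 0 <= u' by exact: le_trans uu'.
have Ene : (E !=set0)%classic by exists (H u), u => //=; rewrite u0.
have Eub : has_ubound E.
  exists (u' * B + u' * `|G u'|) => _ [x /= x0u' <-]; rewrite /H.
  have /andP[x0 xu'] := x0u'.
  rewrite lerD// ?ler_wpM2l ?HB// -mulrN (@le_trans _ _ (x * `|G u'|))//.
    by rewrite ler_wpM2l// -normrN ler_norm.
  by rewrite ler_wpM2r.
have HE x : 0 <= x <= u' -> H x <= sup E.
  by move=> xu'; apply: ub_le_sup => //; exists x.
have Hmid w d : 0 <= d <= w -> 2 * H w <= H (w + d) + H (w - d).
  move=> dw; have := ler_wpM2l u'0 (Gmid _ _ dw); rewrite /H; lra.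
have H0 : H 0 = 0 by rewrite /H G0; ring.
have Hu' : H u' = 0 by rewrite /H; ring.
have Hhalf x : 0 <= x <= u' -> H x <= sup E / 2.
  move=> /andP[x0 xu']; have [xs|xs] := leP x (u' - x).
    have := Hmid x x; rewrite subrr H0 lexx x0 => /(_ isT).
    have : H (x + x) <= sup E by apply: HE; lra.
    lra.
  have := Hmid x (u' - x); have -> : x + (u' - x) = u' by ring.
  rewrite Hu'; have -> : 0 <= u' - x <= x by lra.
  have : H (x - (u' - x)) <= sup E by apply: HE; lra.
  by move=> ? /(_ isT); lra.
have sE : sup E <= sup E / 2.
  by apply: ge_sup => // _ [x /= xu' <-]; exact: Hhalf.
have : H u <= sup E by apply: HE; rewrite u0.
rewrite /H; lra.
Qed.

Section schur.
Context {R : realType}.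
Variable k : R -> R.
Hypothesis k_even : forall x, k (- x) = k x.
Hypothesis k_bd : forall a, exists B, forall x, `|x| <= a -> `|k x| <= B.
Hypothesis k_mix : forall u u' v v' : R, 0 <= u <= u' -> 0 <= v <= v' ->
  k (u' + v) + k (u' - v) + (k (u + v') + k (u - v')) <=
  k (u' + v') + k (u' - v') + (k (u + v) + k (u - v)).

(** The hypothesis [k_mix] implies that the increment [k (u + h) - k (u - h)] is
    midpoint convex in [u >= 0]; it vanishes at [0] since [k] is even. *)
Let increment_star (h u u' : R) : 0 <= h -> 0 <= u <= u' ->
  u' * (k (u + h) - k (u - h)) <= u * (k (u' + h) - k (u' - h)).
Proof.
move=> h0; apply: (@midpoint_convex_star _ (fun u => k (u + h) - k (u - h))).
- by rewrite !add0r k_even subrr.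
- move=> w d /andP[d0 dw].
  (* [k_mix] needs a nonnegative second pair, and [h - d / 2] may be negative. *)
  have hd u1 : k (u1 - `|h - d / 2|) + k (u1 + `|h - d / 2|) =
               k (u1 - (h - d / 2)) + k (u1 + (h - d / 2)).
    by case: (ger0P (h - d / 2)) => // _; rewrite opprK addrC.
  have := @k_mix (w - d / 2) (w + d / 2) `|h - d / 2| (h + d / 2).
  have -> : 0 <= w - d / 2 <= w + d / 2 by lra.
  have -> : 0 <= `|h - d / 2| <= h + d / 2.
    by rewrite normr_ge0/= ler_norml; lra.
  move=> /(_ isT isT).
  have := hd (w + d / 2); have := hd (w - d / 2).
  have -> : w - d / 2 - (h - d / 2) = w - h by ring.
  have -> : w + d / 2 - (h - d / 2) = w - h + d by field.
  have -> : w - d / 2 + (h - d / 2) = w + h - d by field.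
  have -> : w + d / 2 + (h - d / 2) = w + h by ring.
  have -> : w + d / 2 + (h + d / 2) = w + h + d by field.
  have -> : w + d / 2 - (h + d / 2) = w - h by ring.
  have -> : w - d / 2 + (h + d / 2) = w + h by ring.
  have -> : w - d / 2 - (h + d / 2) = w - h - d by field.
  have -> : w + d + h = w + h + d by ring.
  have -> : w - d + h = w + h - d by ring.
  have -> : w + d - h = w - h + d by ring.
  have -> : w - d - h = w - h - d by ring.
  lra.
- move=> a; have [B HB] := k_bd (a + h); exists (B + B) => x /andP[x0 xa].
  rewrite lerD//.
    by rewrite (le_trans (ler_norm _))// HB// ger0_norm; lra.
  rewrite (le_trans (ler_norm _))// normrN HB// ler_norml; lra.
Qed.

(** The slope of [k] between [y] and [x], as a function of the square, is
    [(k (u + h) - k (u - h)) / (4 u h)] with [u, h] the half sum and the half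
    difference. For even [k] it is symmetric in [u] and [h], so
    [increment_star] makes it nondecreasing in each of them, and both grow
    with [x]. *)
Lemma square_convex y m x : 0 <= y <= m -> m <= x ->
  (x ^+ 2 - y ^+ 2) * (k m - k y) <= (m ^+ 2 - y ^+ 2) * (k x - k y).
Proof.
move=> /andP[y0 ym] mx.
have [h1 h10] : {h1 | h1 = (m - y) / 2} by exists ((m - y) / 2).
have [u1 u10] : {u1 | u1 = (m + y) / 2} by exists ((m + y) / 2).
have [h2 h20] : {h2 | h2 = (x - y) / 2} by exists ((x - y) / 2).
have [u2 u20] : {u2 | u2 = (x + y) / 2} by exists ((x + y) / 2).
have := @increment_star h1 u1 u2 _ _; have -> : 0 <= u1 <= u2 by lra.
have := @increment_star u2 h1 h2 _ _; have -> : 0 <= h1 <= h2 by lra.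
have -> : 0 <= h1 by lra. have -> : 0 <= u2 by lra.
move=> /(_ isT isT) + /(_ isT isT).
rewrite (_ : u1 + h1 = m); last by rewrite u10 h10; field.
rewrite (_ : u1 - h1 = y); last by rewrite u10 h10; field.
rewrite (_ : h2 + u2 = x); last by rewrite u20 h20; field.
rewrite -(opprB u2 h2) k_even (_ : u2 - h2 = y); last by rewrite u20 h20; field.
rewrite -(opprB u2 h1) k_even (addrC h1).
have u10' : 0 <= u1 by lra. have h20' : 0 <= h2 by lra.
move=> /(ler_wpM2l u10') A /(ler_wpM2l h20') B.
have -> : x ^+ 2 - y ^+ 2 = 4 * (h2 * u2) by rewrite h20 u20; field.
have -> : m ^+ 2 - y ^+ 2 = 4 * (u1 * h1) by rewrite h10 u10; field.
rewrite -!mulrA ler_pM2l//.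
rewrite (le_trans B)// mulrCA.
by rewrite mulrCA (le_trans _ A)// le_eqVlt; apply/orP; left; apply/eqP; ring.
Qed.

(** Majorization: the convex function [w |-> k (sqrt w)] has the larger sum at
    the more spread of two pairs with equal sums. *)
Lemma square_schur y1 y2 z1 z2 : y1 ^+ 2 + y2 ^+ 2 = z1 ^+ 2 + z2 ^+ 2 ->
  `|z1| <= `|y1| -> `|z2| <= `|y1| -> k z1 + k z2 <= k y1 + k y2.
Proof.
have kabs x : k x = k `|x| by case: (ger0P x) => // _; rewrite k_even.
rewrite -[y1 ^+ 2]real_normK ?num_real// -[y2 ^+ 2]real_normK ?num_real//.
rewrite -[z1 ^+ 2]real_normK ?num_real// -[z2 ^+ 2]real_normK ?num_real//.
rewrite (kabs y1) (kabs y2) (kabs z1) (kabs z2).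
move: (normr_ge0 y1) (normr_ge0 y2) (normr_ge0 z1) (normr_ge0 z2).
move: `|y1| `|y2| `|z1| `|z2| => x y m n x0 y0 m0 n0 e mx nx.
have mx2 : m ^+ 2 <= x ^+ 2 by rewrite ler_sqr ?nnegrE.
have nx2 : n ^+ 2 <= x ^+ 2 by rewrite ler_sqr ?nnegrE.
have ym : y <= m by rewrite -ler_sqr ?nnegrE//; lra.
have yn : y <= n by rewrite -ler_sqr ?nnegrE//; lra.
have := @square_convex y m x; rewrite y0 ym mx => /(_ isT isT) A.
have := @square_convex y n x; rewrite y0 yn nx => /(_ isT isT) B.
have [xy|xy] := ltP y x.
  have xy2 : 0 < x ^+ 2 - y ^+ 2 by rewrite subr_gt0 ltr_sqr// nnegrE.
  have en : n ^+ 2 = x ^+ 2 + y ^+ 2 - m ^+ 2 by rewrite e; ring.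
  by rewrite en in B; rewrite -(ler_pM2l xy2); lra.
have -> : m = y by lra.
have -> : n = y by lra.
by have -> : x = y by lra.
Qed.

End schur.

(** * Mixed differences of powers *)

(** All comparisons are reversed between [p >= 2] and [p <= 2]; the boolean
    selects the direction, so that both cases share one proof. *)
Definition dle {R : realType} (s : bool) (x y : R) := if s then x <= y else y <= x.

Lemma dleE {R : realType} s (x y : R) :
  dle s x y = (0 <= (if s then 1 else -1) * (y - x)).
Proof. by case: s; rewrite /dle ?mul1r ?mulN1r ?opprB subr_ge0. Qed.

Lemma dle_trans {R : realType} s (y x z : R) : dle s x y -> dle s y z -> dle s x z.
Proof. by rewrite !dleE; lra. Qed.

Lemma powR_convex {R : realType} (r t x y : R) : 1 <= r -> 0 <= t <= 1 ->
  0 <= x -> 0 <= y ->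
  (t * x + (1 - t) * y) `^ r <= t * x `^ r + (1 - t) * y `^ r.
Proof.
move=> r1 /andP[t0 t1] x0 y0.
have := @convex_powR R r r1 (Itv01 t0 t1) x y.
rewrite !inE/= !in_itv/= x0 y0 => /(_ isT isT).
by rewrite !convRE.
Qed.

(** Convexity of the inverse power, applied to [x^r] and [y^r]. *)
Lemma powR_concave {R : realType} (r t x y : R) : 0 < r <= 1 -> 0 <= t <= 1 ->
  0 <= x -> 0 <= y ->
  t * x `^ r + (1 - t) * y `^ r <= (t * x + (1 - t) * y) `^ r.
Proof.
move=> /andP[r0 r1] /andP[t0 t1] x0 y0.
have rV : 1 <= r^-1 by rewrite invr_ge1// unitfE gt_eqF.
have w0 : 0 <= t * x `^ r + (1 - t) * y `^ r.
  by rewrite addr_ge0// mulr_ge0 ?powR_ge0//; lra.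
have e z : 0 <= z -> (z `^ r) `^ r^-1 = z.
  by move=> z0; rewrite -powRrM divff ?gt_eqF// powRr1.
have t01 : 0 <= t <= 1 by rewrite t0.
have := powR_convex rV t01 (powR_ge0 x r) (powR_ge0 y r).
rewrite !e// => /(ge0_ler_powR (ltW r0) (powR_ge0 _ _)).
rewrite nnegrE -powRrM mulVf ?gt_eqF// powRr1//; apply.
by rewrite addr_ge0// mulr_ge0//; lra.
Qed.

(** Increments over a fixed length grow for a convex power and shrink for a
    concave one: [x + l] and [y] are complementary convex combinations of [x]
    and [y + l]. *)
Lemma powR_increment {R : realType} s (r x y l : R) :
    (if s then 1 <= r else 0 < r <= 1) -> 0 <= x <= y -> 0 <= l ->
  dle s ((x + l) `^ r + y `^ r) ((y + l) `^ r + x `^ r).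
Proof.
move=> rs /andP[x0 xy] l0.
have [yx|yx] := eqVneq (y + l) x.
  have -> : l = 0 by lra.
  have -> : y = x by lra.
  by rewrite !addr0 dleE subrr mulr0.
have d0 : 0 < y + l - x by rewrite lt_def subr_eq0 yx/=; lra.
pose t := (y - x) / (y + l - x).
have t01 : 0 <= t <= 1.
  by rewrite /t divr_ge0 ?(ltW d0) ?ler_pdivrMr//=; lra.
have t01' : 0 <= 1 - t <= 1 by lra.
have e1 : x + l = t * x + (1 - t) * (y + l) by rewrite /t; field; rewrite gt_eqF.
have e2 : y = (1 - t) * x + (1 - (1 - t)) * (y + l).
  by rewrite /t; field; rewrite gt_eqF.
have yl0 : 0 <= y + l by lra.
case: s rs => rs; rewrite /dle.
  have := powR_convex rs t01 x0 yl0; have := powR_convex rs t01' x0 yl0.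
  rewrite -e1 -e2; lra.
have := powR_concave rs t01 x0 yl0; have := powR_concave rs t01' x0 yl0.
rewrite -e1 -e2; lra.
Qed.

(** Up to a factor, the derivative of [|x|^(r + 1)]. *)
Definition spow {R : realType} (r x : R) := Num.sg x * `|x| `^ r.

Lemma spow_ge0 {R : realType} (r x : R) : 0 < r -> 0 <= x -> spow r x = x `^ r.
Proof.
move=> r0; rewrite le_eqVlt => /predU1P[<-|x0].
  by rewrite /spow sgr0 mul0r powR0// gt_eqF.
by rewrite /spow gtr0_sg// mul1r gtr0_norm.
Qed.

Lemma spowN {R : realType} (r x : R) : spow r (- x) = - spow r x.
Proof. by rewrite /spow sgrN normrN mulNr. Qed.

(** On either side of [v = u] this is [powR_increment] for intervals of length
    [v' - v]; at [v = u] the term [u - v] changes sign. *)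
Lemma spow_increment {R : realType} s (r u v v' : R) :
    (if s then 1 <= r else 0 < r <= 1) -> 0 <= u -> 0 <= v <= v' ->
  dle s (spow r (u + v) + spow r (u - v)) (spow r (u + v') + spow r (u - v')).
Proof.
move=> rs u0; have r0 : 0 < r by case: s rs => [|/andP[]//]; exact: lt_le_trans.
have lo v1 v2 : 0 <= v1 <= v2 -> v2 <= u ->
  dle s (spow r (u + v1) + spow r (u - v1)) (spow r (u + v2) + spow r (u - v2)).
  move=> /andP[v10 v12] v2u; rewrite !spow_ge0//; try lra.
  have := @powR_increment _ s r (u - v2) (u + v1) (v2 - v1) rs.
  have -> : 0 <= u - v2 <= u + v1 by lra.
  have -> : u - v2 + (v2 - v1) = u - v1 by ring.
  have -> : u + v1 + (v2 - v1) = u + v2 by ring.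
  rewrite subr_ge0 !dleE => /(_ isT v12); lra.
have hi v1 v2 : 0 <= v1 <= v2 -> u <= v1 ->
  dle s (spow r (u + v1) + spow r (u - v1)) (spow r (u + v2) + spow r (u - v2)).
  move=> /andP[v10 v12] uv1.
  rewrite -(opprB v1) -(opprB v2) !spowN !spow_ge0//; try lra.
  have := @powR_increment _ s r (v1 - u) (u + v1) (v2 - v1) rs.
  have -> : 0 <= v1 - u <= u + v1 by lra.
  have -> : v1 - u + (v2 - v1) = v2 - u by ring.
  have -> : u + v1 + (v2 - v1) = u + v2 by ring.
  rewrite subr_ge0 !dleE => /(_ isT v12); lra.
move=> /andP[v0 vv'].
have [v'u|uv'] := leP v' u; first by apply: lo => //; rewrite v0.
have [vu|uv] := leP u v; first by apply: hi => //; rewrite v0.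
apply: (@dle_trans _ _ (spow r (u + u) + spow r (u - u))).
  by apply: lo => //; rewrite v0 ltW.
by apply: hi => //; rewrite u0 ltW.
Qed.

Lemma is_derive_normpow {R : realType} (p x : R) : 1 < p ->
  is_derive x 1 (fun x => `|x| `^ p) (p * spow (p - 1) x).
Proof.
move=> p1; have p10 : 0 < p - 1 by lra.
have pos (y : R) : 0 < y -> is_derive y 1 (fun x => `|x| `^ p) (p * spow (p - 1) y).
  move=> y0; rewrite spow_ge0 ?ltW//.
  apply: near_eq_is_derive (is_derive1_powR p y0).
  near=> z; rewrite ger0_norm//; near: z; near do rewrite ltW//.
  exact: lt_nbhsr.
have [x0|x0|->] := ltrgt0P x.
- exact: pos.
- have := pos (- x); rewrite oppr_gt0 => /(_ x0) d.
  have -> : (fun x => `|x| `^ p) = (fun x => `|x| `^ p) \o (-%R : R -> R).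
    by apply/funext => y /=; rewrite normrN.
  have dN : is_derive x 1 (-%R : R -> R) (-1).
    exact: (is_deriveN (is_derive_id x 1)).
  apply: is_derive_eq (is_derive1_comp d dN) _.
  by rewrite spowN /=; ring.
rewrite /spow sgr0 mul0r mulr0.
apply/is_derive1_caratheodory; exists (spow (p - 1)); split.
- move=> z; rewrite normr0 powR0 ?subr0; last by rewrite gt_eqF//; lra.
  rewrite /spow mulrAC -normrEsg mulr_powRB1//; lra.
- have s0 : spow (p - 1) 0 = 0 :> R by rewrite /spow sgr0 mul0r.
  rewrite /prop_for/= /continuous_at s0.
  apply/cvgr0Pnorm_lt => e e0; near=> z.
  have: `|z| < e `^ (p - 1)^-1.
    by near: z; exact: (@nbhs0_lt R R _ (powR_gt0 _ e0)).
  have [->|z0] := eqVneq z 0; first by rewrite s0 normr0.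
  rewrite /spow normrM normr_sg z0 mul1r (ger0_norm (powR_ge0 _ _)) => ze.
  have := gt0_ltr_powR p10 _ _ ze.
  rewrite -powRrM mulVf ?gt_eqF// powRr1 ?ltW//; apply; rewrite nnegrE//.
  exact: powR_ge0.
- by rewrite /spow sgr0 mul0r.
Unshelve. all: by end_near. Qed.


(** The function [h (u + v) + h (u - v)] is supermodular on the positive
    quadrant ([s = true]), or submodular ([s = false]). For smooth even [h]
    this means that [h''] is monotone in [|x|], but the condition is stated
    without derivatives, so that it survives integration and covers [p < 2],
    where [|x|^p] is not twice differentiable. *)
Definition mixed_monotone {R : realType} (s : bool) (h : R -> R) :=
  forall u u' v v' : R, 0 <= u <= u' -> 0 <= v <= v' ->
  dle s (h (u' + v) + h (u' - v) + (h (u + v') + h (u - v')))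
        (h (u' + v') + h (u' - v') + (h (u + v) + h (u - v))).

Lemma mixed_monotone_norm {R : realType} : mixed_monotone false (@Num.norm R R).
Proof.
have e (u v : R) : 0 <= u -> 0 <= v -> `|u + v| + `|u - v| = 2 * Num.max u v.
  move=> u0 v0; rewrite ger0_norm ?addr_ge0//.
  by case: (leP u v) => uv; [rewrite ler0_norm|rewrite ger0_norm]; lra.
move=> u u' v v' /andP[u0 uu'] /andP[v0 vv'] /=.
rewrite !e//; try lra.
case: (leP u v); case: (leP u' v); case: (leP u v'); case: (leP u' v'); lra.
Qed.

(** Differentiating in [u] reduces the second-order condition on [|x|^p] to the
    first-order one on [spow (p - 1)]; for [p = 1] there is no derivative
    at [0]. *)
Lemma mixed_monotone_normpow {R : realType} s (p : R) :
    (if s then 2 <= p else 1 <= p <= 2) ->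
  mixed_monotone s (fun x : R => `|x| `^ p).
Proof.
move=> ps; have [p1|p1] := eqVneq p 1.
  move: ps; rewrite p1; case: s => [|_]; first by lra.
  have -> : (fun x : R => `|x| `^ 1) = Num.norm.
    by apply/funext => x; rewrite powRr1.
  exact: mixed_monotone_norm.
have {}p1 : 1 < p by rewrite lt_def p1; case: s ps; lra.
have rs : if s then 1 <= p - 1 else 0 < p - 1 <= 1 by case: s ps; lra.
move=> u u' v v' /andP[u0 uu'] vv'; rewrite dleE; set e : R := if s then _ else _.
pose g (w x : R) := `|x + w| `^ p : R.
pose F := (e *: (g v' + g (- v') - (g v + g (- v)))) : R -> R.
have dg (w x : R) : is_derive x 1 (g w) (p * spow (p - 1) (x + w)).
  have dD : is_derive x 1 (fun y : R => y + w) 1.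
    by apply: is_derive_eq; rewrite addr0.
  apply: is_derive_eq (is_derive1_comp (is_derive_normpow _ p1) dD) _.
  by rewrite mulr1.
have dF (x : R) : is_derive x 1 F (e * (p * (spow (p - 1) (x + v') +
    spow (p - 1) (x - v') - (spow (p - 1) (x + v) + spow (p - 1) (x - v))))).
  apply: is_derive_eq; rewrite /GRing.scale/=; ring.
have : F u <= F u'.
  apply: (@ger0_derive1_ndecry _ F 0) => //.
  - move=> x; rewrite in_itv/= andbT => x0; rewrite derive1E derive_val mulrCA.
    rewrite mulr_ge0//; first by lra.
    by have := spow_increment rs (ltW x0) vv'; rewrite dleE.
  - apply: continuous_subspaceT => x.
    exact/differentiable_continuous/derivable1_diffP.
have FE x : F x = e * (g v' x + g (- v') x - (g v x + g (- v) x)) by [].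
by rewrite !FE /g; lra.
Qed.

(** * Invariance of the Lebesgue measure *)

Section lebesgue_invariance.
Local Open Scope classical_set_scope.
Local Open Scope ereal_scope.
Context {R : realType}.
Notation mu := (@lebesgue_measure R).
Notation mu2 := (mu \x mu)%E.

Lemma ge0_integral_translate (h : R -> \bar R) (c : R) :
    measurable_fun [set: R] h -> (forall x, 0 <= h x) ->
  \int[mu]_x h (x + c)%R = \int[mu]_x h x.
Proof.
move=> mh h0; have mD : measurable_fun [set: R] (fun x : R => x + c)%R.
  exact: measurable_funD.
rewrite -[LHS]/(\int[mu]_(x in ((fun x => x + c)%R : measurableTypeR R -> measurableTypeR R) @^-1` setT) (h \o (fun x => x + c)%R) x).
rewrite -ge0_integral_pushforward//.
apply: eq_measure_integral => A mA _ /=.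
apply/esym/lebesgue_measure_unique => //= _ [[a b]] _ <-.
rewrite /pushforward /= [X in _ = mu X](_ : _ = `](a - c)%R, (b - c)%R]); last first.
  by apply/seteqP; split => x /=; rewrite !in_itv/= ltrBlDr lerBrDr.
rewrite !lebesgue_measure_itv/= !lte_fin ltrD2r.
by case: ifPn => // _; rewrite -!EFinD; congr (_%:E); ring.
Qed.

Lemma ge0_integral_reflect (h : R -> \bar R) :
    measurable_fun [set: R] h -> (forall x, 0 <= h x) ->
  \int[mu]_x h (- x)%R = \int[mu]_x h x.
Proof.
move=> mh h0.
rewrite -[LHS]/(\int[mu]_(x in (-%R : measurableTypeR R -> measurableTypeR R) @^-1` setT) (h \o -%R) x).
rewrite -ge0_integral_pushforward//.
by apply: eq_measure_integral => A mA _ /=; exact: lebesgue_measureN.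
Qed.

Definition area_preserving (f : R * R -> R * R) :=
  measurable_fun [set: R * R] f /\
  forall G : R * R -> \bar R, measurable_fun [set: R * R] G ->
    (forall z, 0 <= G z) -> \int[mu2]_z G (f z) = \int[mu2]_z G z.

Lemma area_preserving_comp (f g : R * R -> R * R) :
  area_preserving f -> area_preserving g -> area_preserving (f \o g).
Proof.
move=> [mf fE] [mg gE]; split; first exact: measurableT_comp.
move=> G mG G0; have mGf : measurable_fun [set: R * R] (G \o f).
  exact: measurableT_comp.
by rewrite -(fE _ mG G0); apply: (gE (G \o f)) => // z; exact: G0.
Qed.

Lemma area_preserving_shear (t : R) :
  area_preserving (fun z => (z.1 + t * z.2, z.2)%R).
Proof.
have ms : measurable_fun [set: R * R] (fun z => (z.1 + t * z.2, z.2)%R).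
  by apply: measurable_fun_pair => //; apply: measurable_funD => //;
    exact: measurable_funM.
split=> // G mG G0.
rewrite fubini_tonelli2//=; last exact: measurableT_comp mG ms.
rewrite [RHS]fubini_tonelli2//; apply: eq_integral => y _; rewrite /fubini_G/=.
apply: (ge0_integral_translate (h := fun x => G (x, y))) => //.
by apply: measurableT_comp => //; exact: measurable_fun_pair.
Qed.

Lemma area_preserving_swap : area_preserving (fun z => (z.2, z.1)).
Proof.
have ms : measurable_fun [set: R * R] (fun z => (z.2, z.1)).
  exact: measurable_fun_pair.
split=> // G mG G0.
rewrite fubini_tonelli1//=; last exact: measurableT_comp mG ms.
by rewrite [RHS]fubini_tonelli2.
Qed.

Lemma area_preserving_flip : area_preserving (fun z => (z.1, - z.2)%R).
Proof.
have ms : measurable_fun [set: R * R] (fun z => (z.1, - z.2)%R).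
  by apply: measurable_fun_pair => //; exact: measurableT_comp.
split=> // G mG G0.
rewrite fubini_tonelli1//=; last exact: measurableT_comp mG ms.
rewrite [RHS]fubini_tonelli1//; apply: eq_integral => x _; rewrite /fubini_F/=.
apply: (ge0_integral_reflect (h := fun y => G (x, y))) => //.
by apply: measurableT_comp => //; exact: measurable_fun_pair.
Qed.

(** The rotation of angle [theta] is the product of the horizontal shear by
    [- tan (theta / 2)], the vertical shear by [sin theta] and the first shear
    again; here [t = tan (theta / 2)]. The bound on [c] keeps [theta] away
    from pi, where that tangent is infinite. *)
Lemma area_preserving_reflection (c s : R) :
    (c ^+ 2 + s ^+ 2 = 1)%R -> (0 <= c)%R ->
  area_preserving (fun z => (c * z.1 + s * z.2, s * z.1 - c * z.2)%R).
Proof.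
move=> cs c0; pose t := (s / (1 + c))%R.
have c1 : (1 + c != 0)%R by rewrite gt_eqF// ltr_pwDl.
have st : (s = t * (1 + c))%R by rewrite /t; field.
have ts : (t * s = 1 - c)%R.
  rewrite /t mulrAC -expr2 (_ : s ^+ 2 = (1 + c) * (1 - c))%R; first by field.
  by lra.
set f := (X in area_preserving X).
suff -> : f = (fun z => (z.1 + - t * z.2, z.2)%R) \o
    ((fun z => (z.2, z.1)) \o ((fun z => (z.1 + s * z.2, z.2)%R) \o
    ((fun z => (z.2, z.1)) \o ((fun z => (z.1 + - t * z.2, z.2)%R) \o
    (fun z => (z.1, - z.2)%R))))).
  do ![apply: area_preserving_comp; first by
    [exact: area_preserving_shear | exact: area_preserving_swap]].
  exact: area_preserving_flip.
apply/funext => -[x y]; rewrite /f /=; congr (_, _).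
  transitivity (x * (1 - t * s) + y * (t + t * (1 - t * s)))%R; last by ring.
  by rewrite ts [in LHS]st; ring.
transitivity (s * x - (1 - t * s) * y)%R; last by ring.
by rewrite ts; ring.
Qed.

End lebesgue_invariance.

(** * Two variables *)

Definition elee {R : realType} (s : bool) (x y : \bar R) :=
  if s then (x <= y)%E else (y <= x)%E.

(** On each circle the product decreases as the larger coordinate grows. For
    [f = exp (- V)] this is [square_schur] for [V]; it is stated for products
    so that [f] may vanish, as the uniform density does. *)
Definition schur_product {R : realType} (f : R -> R) := forall y1 y2 z1 z2 : R,
  (y1 ^+ 2 + y2 ^+ 2 = z1 ^+ 2 + z2 ^+ 2 -> `|z1| <= `|y1| -> `|z2| <= `|y1| ->
  f y1 * f y2 <= f z1 * f z2)%R.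

Definition schur_sum {R : realType} (b : bool) (h : R -> R) := forall y1 y2 z1 z2 : R,
  (y1 ^+ 2 + y2 ^+ 2 = z1 ^+ 2 + z2 ^+ 2 -> `|z1| <= `|y1| -> `|z2| <= `|y1| ->
  dle b (h z1 + h z2) (h y1 + h y2))%R.

(** Of two points on a circle, the one with the larger maximal coordinate has
    the larger [h]-sum and the smaller [f]-product. *)
Lemma schur_exchange {R : realType} b (f h : R -> R) (y1 y2 z1 z2 : R) :
    schur_product f -> schur_sum b h ->
    (y1 ^+ 2 + y2 ^+ 2 = z1 ^+ 2 + z2 ^+ 2)%R ->
  dle b ((h y1 + h y2) * (f y1 * f y2) + (h z1 + h z2) * (f z1 * f z2))%R
        ((h z1 + h z2) * (f y1 * f y2) + (h y1 + h y2) * (f z1 * f z2))%R.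
Proof.
move=> Pf Sh.
wlog dom : y1 y2 z1 z2 / (`|z1| <= `|y1| /\ `|z2| <= `|y1|)%R.
  move=> ih e.
  have hC (x y : R) : (h x + h y = h y + h x)%R by rewrite addrC.
  have fC (x y : R) : (f x * f y = f y * f x)%R by rewrite mulrC.
  have [A|A] := leP (Num.max `|z1| `|z2|) (Num.max `|y1| `|y2|).
    have [yy|yy] := leP `|y2| `|y1|.
      apply: ih => //; move: A; rewrite [X in (_ <= X)%R]max_l// ge_max.
      by move/andP.
    rewrite (hC y1) (fC y1); apply: ih; last by rewrite addrC.
    move: A; rewrite [X in (_ <= X)%R]max_r ?(ltW yy)// ge_max.
    by move/andP.
  suff: dle b ((h z1 + h z2) * (f z1 * f z2) + (h y1 + h y2) * (f y1 * f y2))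
              ((h y1 + h y2) * (f z1 * f z2) + (h z1 + h z2) * (f y1 * f y2)).
    by rewrite !dleE; case: (b); lra.
  have {}A := ltW A; have [zz|zz] := leP `|z2| `|z1|.
    apply: ih; last exact/esym.
    move: A; rewrite [X in (_ <= X)%R]max_l// ge_max.
    by move/andP.
  rewrite (hC z1) (fC z1); apply: ih; last by rewrite addrC.
  move: A; rewrite [X in (_ <= X)%R]max_r ?(ltW zz)// ge_max.
  by move/andP.
case: dom => d1 d2 e.
have A := Pf _ _ _ _ e d1 d2; have := Sh _ _ _ _ e d1 d2.
rewrite !dleE; move: (if b then _ else _) => ep B.
have : (0 <= (ep * (h y1 + h y2 - (h z1 + h z2))) * (f z1 * f z2 - f y1 * f y2))%R.
  by rewrite mulr_ge0// subr_ge0.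
lra.
Qed.

Section two_variables.
Local Open Scope classical_set_scope.
Local Open Scope ereal_scope.
Context {R : realType}.
Notation mu := (@lebesgue_measure R).
Notation mu2 := (mu \x mu)%E.

(** The reflection argument for two variables. Every integrand is nonnegative
    and [schur_exchange] is written without subtraction, so the integrals may
    be infinite. *)
Lemma rotation_extremal b (f h : R -> R) (c s : R) :
    (c ^+ 2 + s ^+ 2 = 1)%R -> (0 <= c)%R ->
    measurable_fun [set: R] f -> (forall x, 0 <= f x)%R ->
    (forall x, f (- x) = f x)%R -> schur_product f ->
    measurable_fun [set: R] h -> (forall x, 0 <= h x)%R ->
    (forall x, h (- x) = h x)%R -> schur_sum b h ->
  elee b (\int[mu2]_z (h z.1 * (f z.1 * f z.2))%:E)
        (\int[mu2]_z (h (c * z.1 + s * z.2) * (f z.1 * f z.2))%:E).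
Proof.
move=> cs c0 mf f0 fN Pf mh h0 hN Sh.
pose F z := (f z.1 * f z.2)%R.
pose sg z := (c * z.1 + s * z.2, s * z.1 - c * z.2)%R : R * R.
have [msg sgE] : area_preserving sg := area_preserving_reflection cs c0.
have sgK z : sg (sg z) = z.
  case: z => x y; rewrite /sg /=; congr (_, _).
    by rewrite -[RHS]mul1r -cs; ring.
  by rewrite -[RHS]mul1r -cs; ring.
have mF : measurable_fun [set: R * R] F.
  by apply: measurable_funM; exact: measurableT_comp.
have F0 z : (0 <= F z)%R by rewrite mulr_ge0.
pose H z := (h z.1 + h z.2)%R.
have H0 z : (0 <= H z)%R by rewrite addr_ge0.
have mH : measurable_fun [set: R * R] H.
  by apply: measurable_funD; exact: measurableT_comp.
have mE (u : R * R -> R) : measurable_fun [set: R * R] u ->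
  measurable_fun [set: R * R] (fun z => (u z * F z)%:E).
  by move=> mu_; apply/measurable_EFinP; exact: measurable_funM.
have mh1 : measurable_fun [set: R * R] (fun z => h z.1) by exact: measurableT_comp.
have mh2 : measurable_fun [set: R * R] (fun z => h z.2) by exact: measurableT_comp.
have msg1 : measurable_fun [set: R * R] (fun z => h (sg z).1).
  exact: measurableT_comp mh1 msg.
have msg2 : measurable_fun [set: R * R] (fun z => h (sg z).2).
  exact: measurableT_comp mh2 msg.
rewrite -[X in elee _ X _]/(\int[mu2]_z (h z.1 * F z)%:E).
rewrite -[X in elee _ _ X]/(\int[mu2]_z (h (sg z).1 * F z)%:E).
set A := (X in elee _ X _); set B := (X in elee _ _ X).
have swapF z : F (z.2, z.1) = F z by rewrite /F /= mulrC.
have A2 : \int[mu2]_z (h z.2 * F z)%:E = A.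
  rewrite -(area_preserving_swap.2 _ (mE _ mh2))//=.
    by apply: eq_integral => z _; rewrite swapF.
  by move=> z; rewrite lee_fin mulr_ge0.
(* swap the coordinates, use that [h] is even, then change the sign of the
   second coordinate *)
have B2 : \int[mu2]_z (h (sg z).2 * F z)%:E = B.
  rewrite -(area_preserving_swap.2 _ (mE _ msg2))//=; last first.
    by move=> z; rewrite lee_fin mulr_ge0.
  have mG : measurable_fun [set: R * R] (fun z => (h (s * z.2 - c * z.1) * F (z.2, z.1))%:E).
    exact: (measurableT_comp (mE _ msg2) area_preserving_swap.1).
  rewrite -(area_preserving_flip.2 _ mG)//=; last first.
    by move=> z; rewrite lee_fin mulr_ge0.
  apply: eq_integral => z _.
  have -> : (s * - z.2 - c * z.1 = - (c * z.1 + s * z.2))%R by ring.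
  by rewrite hN /F /= fN (mulrC (f z.2)).
have AA : \int[mu2]_z (H z * F z)%:E = A + A.
  rewrite -{2}A2 -ge0_integralD//=; [|by move=> z _; rewrite lee_fin mulr_ge0|
    exact: mE|by move=> z _; rewrite lee_fin mulr_ge0|exact: mE].
  by apply: eq_integral => z _; rewrite -EFinD -mulrDl.
have BB : \int[mu2]_z (H (sg z) * F z)%:E = B + B.
  rewrite -{2}B2 -ge0_integralD//=; [|by move=> z _; rewrite lee_fin mulr_ge0|
    exact: mE|by move=> z _; rewrite lee_fin mulr_ge0|exact: mE].
  by apply: eq_integral => z _; rewrite -EFinD -mulrDl.
have mHs : measurable_fun [set: R * R] (H \o sg) by exact: measurableT_comp.
have mFs : measurable_fun [set: R * R] (F \o sg) by exact: measurableT_comp.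
have AAs : \int[mu2]_z (H (sg z) * F (sg z))%:E = A + A.
  rewrite -AA -(sgE (fun z => (H z * F z)%:E))//; first exact: mE.
  by move=> z; rewrite lee_fin mulr_ge0.
have mHF : measurable_fun [set: R * R] (fun z => (H z * F (sg z))%:E).
  by apply/measurable_EFinP; exact: measurable_funM.
have mHsF : measurable_fun [set: R * R] (fun z => (H (sg z) * F z)%:E).
  by apply/measurable_EFinP; exact: measurable_funM.
have mHsFs : measurable_fun [set: R * R] (fun z => (H (sg z) * F (sg z))%:E).
  by apply/measurable_EFinP; exact: measurable_funM.
have BBs : \int[mu2]_z (H z * F (sg z))%:E = B + B.
  rewrite -BB -(sgE _ mHF).
    by apply: eq_integral => z _; rewrite sgK.
  by move=> z; rewrite lee_fin mulr_ge0.
have key : elee b ((A + A) + (A + A)) ((B + B) + (B + B)).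
  rewrite -{1}AA -AAs -{1}BB -BBs -!ge0_integralD//=;
    try by [exact: mE | move=> z _; rewrite lee_fin mulr_ge0].
  have pw z : dle b (H z * F z + H (sg z) * F (sg z))%R
                    (H (sg z) * F z + H z * F (sg z))%R.
    apply: schur_exchange => //.
    by rewrite /sg/= -[LHS]mul1r -cs; ring.
  case: b Sh pw {A2 B2 AA BB AAs BBs} => Sh pw; apply: ge0_le_integral => //=;
    try by [move=> z _; rewrite -EFinD lee_fin addr_ge0// mulr_ge0
           | move=> z _; rewrite -!EFinD lee_fin; exact: pw
           | apply: emeasurable_funD => //; exact: mE].
have A0 : 0 <= A by apply: integral_ge0 => z _; rewrite lee_fin mulr_ge0.
have B0 : 0 <= B by apply: integral_ge0 => z _; rewrite lee_fin mulr_ge0.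
clearbody A B; move: key A0 B0 {A2 B2 AA BB AAs BBs}; rewrite /elee.
by case: A => [x||]; case: B => [y||] //=; case: (b) => //=;
  rewrite ?leey//; rewrite -?EFinD !lee_fin; lra.
Qed.

End two_variables.

(** * Averaging a test function *)

(** The last field makes the averages of functions of exponential growth
    finite. *)
Record peaked {R : realType} (f : R -> R) : Prop := Peaked {
  peaked_measurable : measurable_fun [set: R] f;
  peaked_ge0 : forall x, 0 <= f x;
  peaked_even : forall x, f (- x) = f x;
  peaked_unimodal : forall x y : R, `|x| <= `|y| -> f y <= f x;
  peaked_schur : schur_product f;
  peaked_expR : forall a,
    (\int[lebesgue_measure]_y (expR (a * `|y|) * f y)%:E < +oo)%E }.

(** Exponential growth rather than polynomial: it is visibly stable under
    averaging, and one bound serves all exponents. *)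
Record test_function {R : realType} (s : bool) (h : R -> R) : Prop := TestFunction {
  test_measurable : measurable_fun [set: R] h;
  test_ge0 : forall x, 0 <= h x;
  test_even : forall x, h (- x) = h x;
  test_growth : exists C, forall x, h x <= C * expR `|x|;
  test_mixed : mixed_monotone s h }.

Lemma test_function_schur {R : realType} s (h : R -> R) :
  test_function s h -> schur_sum s h.
Proof.
move=> [mh h0 hN [C hC] hM].
have bd a : exists B, forall x, `|x| <= a -> `|h x| <= B.
  exists (`|C| * expR a) => x xa; rewrite ger0_norm// (le_trans (hC x))//.
  rewrite (le_trans (ler_wpM2r (expR_ge0 _) (ler_norm C)))//.
  by rewrite ler_wpM2l// ler_expR.
move=> y1 y2 z1 z2 e d1 d2; case: s hM => hM; rewrite /dle.
  exact: (square_schur hN bd hM e d1 d2).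
have hN' x : - h (- x) = - h x by rewrite hN.
have bd' a : exists B, forall x, `|x| <= a -> `|- h x| <= B.
  by have [B HB] := bd a; exists B => x; rewrite normrN; exact: HB.
rewrite -lerN2 !opprD; apply: (@square_schur _ (fun x => - h x)) e d1 d2 => //.
by move=> u u' v v' uu vv; have := hM _ _ _ _ uu vv; rewrite /dle; lra.
Qed.

Section averaging.
Local Open Scope ereal_scope.
Context {R : realType}.
Notation mu := (@lebesgue_measure R).
Variable f : R -> R.
Hypothesis pf : peaked f.
Let mf := peaked_measurable pf.
Let f0 := peaked_ge0 pf.

Definition average (a : R) (h : R -> R) (x : R) : R :=
  fine (\int[mu]_y (h (x + a * y) * f y)%:E).

Variables (s : bool) (h : R -> R).
Hypothesis th : test_function s h.
Let mh := test_measurable th.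
Let h0 := test_ge0 th.

Let mhx (a x : R) : measurable_fun [set: R] (fun y => h (x + a * y)%R).
Proof.
by apply: measurableT_comp => //; apply: measurable_funD => //; exact: measurable_funM.
Qed.

Let mhf (a x : R) : measurable_fun [set: R] (fun y => (h (x + a * y) * f y)%:E).
Proof. by apply/measurable_EFinP; exact: measurable_funM. Qed.

Let hf0 (a x y : R) : 0 <= (h (x + a * y) * f y)%:E.
Proof. by rewrite lee_fin mulr_ge0. Qed.

Let mexp (a : R) : measurable_fun [set: R] (fun y => (expR (a * `|y|) * f y)%:E).
Proof.
apply/measurable_EFinP; apply: measurable_funM => //.
by apply: measurableT_comp => //; apply: measurable_funM => //; exact: measurableT_comp.
Qed.

Let avg_bound (a : R) : exists2 C, (0 <= C)%R & forall x,
  \int[mu]_y (h (x + a * y) * f y)%:E <= (C * expR `|x|)%:E.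
Proof.
have [C hC] := test_growth th.
have C0 : (0 <= C)%R.
  by have := le_trans (h0 0) (hC 0%R); rewrite normr0 expR0 mulr1.
pose I := \int[mu]_y (expR (`|a| * `|y|) * f y)%:E.
have I0 : 0 <= I by apply: integral_ge0 => y _; rewrite lee_fin mulr_ge0// expR_ge0.
have Ifin : I \is a fin_num by rewrite ge0_fin_numE// (peaked_expR pf).
exists (C * fine I)%R; first by rewrite mulr_ge0// fine_ge0.
move=> x; apply: (@le_trans _ _ (\int[mu]_y ((C * expR `|x|)%:E *
    (expR (`|a| * `|y|) * f y)%:E))).
  apply: ge0_le_integral => //.
  - exact: mhf.
  - by apply: emeasurable_funM => //; exact: mexp.
  - move=> y _; rewrite -EFinM lee_fin mulrA ler_wpM2r//.
    rewrite (le_trans (hC _))// -mulrA -expRD ler_wpM2l// ler_expR.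
    by rewrite (le_trans (ler_normD _ _))// normrM.
rewrite ge0_integralZl//.
- by rewrite -/I -(fineK Ifin) -EFinM lee_fin mulrAC.
- exact: mexp.
- by move=> y _; rewrite lee_fin mulr_ge0// expR_ge0.
- by rewrite lee_fin mulr_ge0// expR_ge0.
Qed.

Lemma averageE (a x : R) :
  (average a h x)%:E = \int[mu]_y (h (x + a * y) * f y)%:E.
Proof.
rewrite /average fineK// ge0_fin_numE; last by apply: integral_ge0.
by have [C _ HC] := avg_bound a; rewrite (le_lt_trans (HC x))// ltry.
Qed.

(** Take [s = true]. The mean of [p (u' + a y) - p (u + a y)] must be
    nonnegative, where [p] is a difference of second differences of [h], even
    and nondecreasing in [|t|]. The reflection [y |-> rf y] that exchanges
    [u' + a y] and [- (u + a y)] changes the sign of this difference. When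
    [u + u' + 2 a y >= 0], the difference is nonnegative at [y] and [rf y] is
    at least as far from the origin as [y]; otherwise both facts are reversed.
    As [f] is even and unimodal, the contributions of [y] and [rf y] add up to
    a nonnegative number. *)
Let average_mixed (a : R) : mixed_monotone s (average a h).
Proof.
move=> u u' v v' /andP[u0 uu'] vv'.
pose A y := (h (u' + v + a * y) + h (u' - v + a * y) +
            (h (u + v' + a * y) + h (u - v' + a * y)))%R.
pose B y := (h (u' + v' + a * y) + h (u' - v' + a * y) +
            (h (u + v + a * y) + h (u - v + a * y)))%R.
have int4 x1 x2 x3 x4 : (average a h x1 + average a h x2 +
    (average a h x3 + average a h x4))%:E =
  \int[mu]_y ((h (x1 + a * y) + h (x2 + a * y) +
              (h (x3 + a * y) + h (x4 + a * y))) * f y)%:E.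
  have mhf2 (z1 z2 : R) : measurable_fun [set: R]
      (fun y => (h (z1 + a * y) * f y)%:E + (h (z2 + a * y) * f y)%:E).
    exact: emeasurable_funD.
  rewrite !EFinD !averageE -!ge0_integralD//=;
    try by [exact: mhf | exact: mhf2 | move=> y _; rewrite adde_ge0].
  by apply: eq_integral => y _; rewrite -!EFinD; congr (_%:E); ring.
suff : elee s (\int[mu]_y (A y * f y)%:E) (\int[mu]_y (B y * f y)%:E).
  by rewrite -!int4 /elee /dle; case: (s); rewrite lee_fin.
have mA : measurable_fun [set: R] A.
  by apply: measurable_funD; apply: measurable_funD.
have mB : measurable_fun [set: R] B.
  by apply: measurable_funD; apply: measurable_funD.
have A0 y : (0 <= A y)%R by rewrite !addr_ge0.
have B0 y : (0 <= B y)%R by rewrite !addr_ge0.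
have mEf (k : R -> R) : measurable_fun [set: R] k ->
    measurable_fun [set: R] (fun y => (k y * f y)%:E).
  by move=> mk; apply/measurable_EFinP; exact: measurable_funM.
pose p t := (h (t + v') + h (t - v') - (h (t + v) + h (t - v)))%R.
have pN t : p (- t)%R = p t.
  have e w : h (- t + w)%R = h (t - w)%R by rewrite -(test_even th) opprD opprK.
  by rewrite /p !e !opprK; ring.
have pM t t' : (`|t| <= `|t'|)%R -> dle s (p t) (p t').
  have pabs w : p w = p `|w|%R by case: (ger0P w) => // _; rewrite pN.
  move=> tt'; rewrite (pabs t) (pabs t').
  have := test_mixed th (u := `|t|%R) (u' := `|t'|%R) _ vv'.
  by rewrite normr_ge0 tt' => /(_ isT); rewrite !dleE /p; case: (s); lra.
have BA y : (B y = A y + (p (u' + a * y) - p (u + a * y)))%R.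
  rewrite /A /B /p.
  have -> : (u' + a * y + v' = u' + v' + a * y)%R by ring.
  have -> : (u' + a * y - v' = u' - v' + a * y)%R by ring.
  have -> : (u' + a * y + v = u' + v + a * y)%R by ring.
  have -> : (u' + a * y - v = u' - v + a * y)%R by ring.
  have -> : (u + a * y + v' = u + v' + a * y)%R by ring.
  have -> : (u + a * y - v' = u - v' + a * y)%R by ring.
  have -> : (u + a * y + v = u + v + a * y)%R by ring.
  have -> : (u + a * y - v = u - v + a * y)%R by ring.
  ring.
have [a0|a0] := eqVneq a 0%R.
  have pw y : dle s (A y * f y)%R (B y * f y)%R.
    have := pM u u'; rewrite !ger0_norm ?(le_trans u0)// => /(_ uu').
    rewrite !dleE BA a0 mul0r !addr0 -mulrBl mulrA => H.
    by rewrite mulr_ge0// addrAC subrr add0r.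
  case: (s) pw => pw; apply: ge0_le_integral => //;
    try by [exact: mEf|move=> y _; rewrite lee_fin mulr_ge0|move=> y _; rewrite lee_fin; exact: pw].
pose rf y := (- y + - ((u + u') / a))%R.
have rfE (k : R -> \bar R) : measurable_fun [set: R] k -> (forall x, 0 <= k x) ->
    \int[mu]_y k (rf y) = \int[mu]_y k y.
  move=> mk k0; rewrite -(ge0_integral_translate (- ((u + u') / a)) mk k0).
  rewrite -[RHS]ge0_integral_reflect//.
  by apply: measurableT_comp => //; exact: measurable_funD.
have mrf : measurable_fun [set: R] rf by apply: measurable_funD => //; exact: measurableT_comp.
have dbl (k : R -> R) : measurable_fun [set: R] k -> (forall x, 0 <= k x)%R ->
    \int[mu]_y (k y * f y + k (rf y) * f (rf y))%:E =
    \int[mu]_y (k y * f y)%:E + \int[mu]_y (k y * f y)%:E.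
  move=> mk k0; rewrite -[X in _ = _ + X](rfE _ (mEf _ mk)); last first.
    by move=> y; rewrite lee_fin mulr_ge0.
  rewrite -ge0_integralD//; try by [exact: mEf|move=> y _; rewrite lee_fin mulr_ge0].
  exact: (measurableT_comp (mEf _ mk) mrf).
have pw y : dle s (A y * f y + A (rf y) * f (rf y))%R
                  (B y * f y + B (rf y) * f (rf y))%R.
  have e1 : (u' + a * rf y = - (u + a * y))%R by rewrite /rf; field.
  have e2 : (u + a * rf y = - (u' + a * y))%R by rewrite /rf; field.
  rewrite !BA e1 e2 !pN dleE; set ep := (if s then _ else _).
  suff : (0 <= (ep * (p (u' + a * y) - p (u + a * y))) * (f y - f (rf y)))%R by lra.
  have a1 : (0 < `|a|)%R by rewrite normr_gt0.
  have e3 : (`|a| * `|rf y| = `|u + u' + a * y|)%R.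
    by rewrite -normrM -normrN; congr (`|_|)%R; rewrite /rf; field.
  have [w0|w0] := leP 0%R (u + u' + 2 * (a * y))%R.
    apply: mulr_ge0.
      rewrite -dleE; apply: pM; rewrite -ler_sqr ?nnegrE// !real_normK ?num_real//.
      by nra.
    rewrite subr_ge0; apply: (peaked_unimodal pf).
    rewrite -(ler_pM2l a1) e3 -normrM -ler_sqr ?nnegrE// !real_normK ?num_real//.
    by nra.
  rewrite -mulrNN; apply: mulr_ge0.
    rewrite -mulrN opprB -dleE; apply: pM.
    rewrite -ler_sqr ?nnegrE// !real_normK ?num_real//.
    by nra.
  rewrite opprB subr_ge0; apply: (peaked_unimodal pf).
  rewrite -(ler_pM2l a1) e3 -normrM -ler_sqr ?nnegrE// !real_normK ?num_real//.
  by nra.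
have mEE (k : R -> R) : measurable_fun [set: R] k ->
    measurable_fun [set: R] (fun y => (k y * f y + k (rf y) * f (rf y))%:E).
  move=> mk; apply/measurable_EFinP; apply: measurable_funD.
    exact: measurable_funM.
  exact: (measurableT_comp (measurable_funM mk mf) mrf).
have : elee s (\int[mu]_y (A y * f y)%:E + \int[mu]_y (A y * f y)%:E)
              (\int[mu]_y (B y * f y)%:E + \int[mu]_y (B y * f y)%:E).
  rewrite -!dbl//; case: (s) pw => pw; apply: ge0_le_integral => //;
    try by [exact: mEE|move=> y _; rewrite lee_fin addr_ge0 ?mulr_ge0
           |move=> y _; rewrite lee_fin; exact: pw].
rewrite -!int4 -!EFinD; case: (s); rewrite /= !lee_fin; lra.
Qed.

Lemma test_function_average (a : R) : test_function s (average a h).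
Proof.
split.
- apply: (measurableT_comp (f := fine)) => //.
  pose g (z : R * R) := (h (z.1 + a * z.2) * f z.2)%:E.
  apply: (@measurable_fun_fubini_tonelli_F _ _ _ _ _ mu g); last first.
    by move=> z; rewrite lee_fin mulr_ge0.
  apply/measurable_EFinP; apply: measurable_funM; last exact: measurableT_comp.
  by apply: measurableT_comp => //; apply: measurable_funD => //; exact: measurable_funM.
- by move=> x; rewrite fine_ge0// integral_ge0.
- move=> x; rewrite /average -ge0_integral_reflect//; congr fine.
  apply: eq_integral => y _; rewrite (peaked_even pf) -(test_even th).
  by congr ((h _ * _)%:E); ring.
- have [C C0 HC] := avg_bound a; exists C => x.
  by rewrite -lee_fin averageE.
- exact: average_mixed.
Qed.

End averaging.

Section two_averages.
Local Open Scope ereal_scope.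
Context {R : realType}.
Notation mu := (@lebesgue_measure R).
Notation mu2 := (mu \x mu)%E.
Variable f : R -> R.
Hypothesis pf : peaked f.
Hypothesis f1 : \int[mu]_y (f y)%:E = 1.

Lemma average0 s (h : R -> R) : test_function s h -> average f 0 h 0 = h 0%R.
Proof.
move=> th; apply/EFin_inj; rewrite (averageE pf th).
under eq_integral do rewrite mul0r addr0 EFinM.
rewrite ge0_integralZl//; first by rewrite f1 mule1.
- by apply/measurable_EFinP; exact: peaked_measurable.
- by move=> y _; rewrite lee_fin peaked_ge0.
- by rewrite lee_fin (test_ge0 th).
Qed.

(** The double average is an expectation of [h (r Y1 + a Y2)]; after dividing by
    [rho = sqrt (r^2 + a^2)] this is [rotation_extremal] for
    [x |-> h (rho x)]. *)
Lemma average_average s (h : R -> R) (r a : R) : (0 <= r)%R ->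
  test_function s h ->
  dle s (average f (Num.sqrt (r ^+ 2 + a ^+ 2)) h 0)
        (average f r (average f a h) 0).
Proof.
move=> r0 th; set rho := Num.sqrt _.
have rho2 : (rho ^+ 2 = r ^+ 2 + a ^+ 2)%R.
  by rewrite sqr_sqrtr// addr_ge0// sqr_ge0.
have tah := test_function_average pf th a.
have [rho0|rho0] := eqVneq rho 0%R.
  have : (r ^+ 2 + a ^+ 2 = 0)%R by rewrite -rho2 rho0 expr0n.
  move/eqP; rewrite paddr_eq0 ?sqr_ge0// !sqrf_eq0 => /andP[/eqP -> /eqP ->].
  have ta0 := test_function_average pf th 0.
  rewrite rho0 (average0 ta0) /dle.
  by case: (s); rewrite lexx.
have rho_gt0 : (0 < rho)%R by rewrite lt_def rho0 sqrtr_ge0.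
pose c := (r / rho)%R; pose t := (a / rho)%R.
have ct : (c ^+ 2 + t ^+ 2 = 1)%R.
  by rewrite /c /t !expr_div_n -mulrDl -rho2 divff// expf_neq0.
have c0 : (0 <= c)%R by rewrite divr_ge0// ltW.
pose hr x := h (rho * x)%R.
have mh := test_measurable th; have h0 := test_ge0 th.
have mf := peaked_measurable pf; have f0 := peaked_ge0 pf.
have mhr : measurable_fun [set: R] hr.
  by apply: measurableT_comp => //; exact: measurable_funM.
have Shr : schur_sum s hr.
  move=> y1 y2 z1 z2 e d1 d2; apply: (test_function_schur th).
  - by rewrite !exprMn -!mulrDr e.
  - by rewrite !normrM ler_wpM2l.
  - by rewrite !normrM ler_wpM2l.
have := rotation_extremal ct c0 mf f0 (peaked_even pf) (peaked_schur pf) mhr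
  (fun x => h0 _) _ Shr.
have hrN x : hr (- x)%R = hr x by rewrite /hr mulrN (test_even th).
move=> /(_ hrN).
have mf1 : measurable_fun [set: R * R] (fun z => f z.1) by exact: measurableT_comp.
have mf2 : measurable_fun [set: R * R] (fun z => f z.2) by exact: measurableT_comp.
have -> : \int[mu2]_z (hr z.1 * (f z.1 * f z.2))%:E = (average f rho h 0)%:E.
  rewrite fubini_tonelli1//=; last 2 first.
  - apply/measurable_EFinP; apply: measurable_funM; last exact: measurable_funM.
    exact: measurableT_comp.
  - by move=> z; rewrite lee_fin !mulr_ge0// h0.
  rewrite (averageE pf th); apply: eq_integral => x _; rewrite /fubini_F/=.
  under eq_integral do rewrite mulrA EFinM.
  rewrite ge0_integralZl//; first by rewrite f1 mule1 /hr add0r.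
  - exact/measurable_EFinP.
  - by move=> y _; rewrite lee_fin.
  - by rewrite lee_fin mulr_ge0// h0.
have -> : \int[mu2]_z (hr (c * z.1 + t * z.2) * (f z.1 * f z.2))%:E =
    (average f r (average f a h) 0)%:E.
  rewrite fubini_tonelli1//=; last 2 first.
  - apply/measurable_EFinP; apply: measurable_funM; last exact: measurable_funM.
    by apply: (measurableT_comp mhr); apply: measurable_funD; exact: measurable_funM.
  - by move=> z; rewrite lee_fin !mulr_ge0// h0.
  rewrite (averageE pf tah); apply: eq_integral => x _; rewrite /fubini_F/=.
  rewrite add0r [in RHS]mulrC [in RHS]EFinM (averageE pf th) -ge0_integralZl//.
  - apply: eq_integral => y _; rewrite -EFinM; congr (_%:E).
    rewrite /hr /c /t mulrCA; congr (_ * (h _ * _))%R.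
    by field.
  - apply/measurable_EFinP; apply: measurable_funM => //.
    by apply: (measurableT_comp mh); apply: measurable_funD => //; exact: measurable_funM.
  - by move=> y _; rewrite lee_fin mulr_ge0// h0.
  - by rewrite lee_fin.
by rewrite /elee /dle; case: (s); rewrite lee_fin.
Qed.

End two_averages.

(** * Sums of independent variables with a density *)

Section density_integral.
Local Open Scope classical_set_scope.
Local Open Scope ereal_scope.
Context {R : realType}.
Notation mu := (@lebesgue_measure R).
Variables (nu : {measure set R -> \bar R}) (f : R -> R).
Hypotheses (mf : measurable_fun [set: R] f) (f0 : forall x, (0 <= f x)%R).
Hypothesis nuE : forall A : set R, measurable A -> nu A = \int[mu]_(x in A) (f x)%:E.

Import HBNNSimple.

Lemma ge0_integral_density (h : R -> \bar R) :
    measurable_fun [set: R] h -> (forall x, 0 <= h x) ->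
  \int[nu]_x h x = \int[mu]_x (h x * (f x)%:E).
Proof.
move=> mh h0.
have mfE : measurable_fun [set: R] (EFin \o f) by exact/measurable_EFinP.
pose g := nnsfun_approx measurableT mh.
have g_cvg x : (g n x)%:E @[n --> \oo] --> h x.
  exact: cvg_nnsfun_approx.
have g_nd x : {homo (fun n => (g n x)%:E) : m n / (m <= n)%N >-> m <= n}.
  by move=> m n mn; rewrite lee_fin; exact/lefP/nd_nnsfun_approx.
have mg n : measurable_fun [set: R] (fun x => (g n x)%:E).
  exact/measurable_EFinP.
transitivity (limn (fun n => \int[nu]_x (g n x)%:E)).
  rewrite -monotone_convergence//=.
  - by apply: eq_integral => x _; apply/esym/cvg_lim => //; exact: g_cvg.
  - by move=> n x _; rewrite lee_fin.
transitivity (limn (fun n => \int[mu]_x ((g n x)%:E * (f x)%:E))); last first.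
  rewrite -monotone_convergence//=.
  - apply: eq_integral => x _; apply/cvg_lim => //.
    by apply: cvgeZr => //; exact: g_cvg.
  - by move=> n; exact: emeasurable_funM (mg n) mfE.
  - by move=> n x _; rewrite mule_ge0// lee_fin.
  - by move=> x _ m n mn; rewrite lee_wpmul2r ?lee_fin//; exact: g_nd.
congr (limn _); apply/funext => n.
have mrn r : measurable_fun [set: R] (fun x => (r * \1_(g n @^-1` [set r]) x)%:E).
  exact/measurable_EFinP/measurableT_comp.
under eq_integral do rewrite fimfunE -fsumEFin//.
rewrite ge0_integral_fsum//; last first.
  by move=> r x _; rewrite EFinM nnfun_muleindic_ge0.
under [RHS]eq_integral.
  move=> x _; rewrite fimfunE -fsumEFin// ge0_mule_fsuml; last first.
    by move=> r; rewrite EFinM nnfun_muleindic_ge0.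
  over.
rewrite [RHS]ge0_integral_fsum//; last 2 first.
  - by move=> r; exact: emeasurable_funM (mrn r) mfE.
  - move=> r x _; apply: mule_ge0; last by rewrite lee_fin.
    by rewrite EFinM nnfun_muleindic_ge0.
apply: eq_fsbigr => r _.
have mr : measurable (g n @^-1` [set r]) by [].
rewrite integralZl_indic_nnsfun// integral_indic//= setIT nuE//.
rewrite integral_mkcond/=.
have patchedE x : ((fun x => (f x)%:E) \_ (g n @^-1` [set r])) x =
    (\1_(g n @^-1` [set r]) x * f x)%:E.
  by rewrite patchE indicE; case: ifP => _; rewrite ?mul1r ?mul0r.
have [r0|r0] := ltP r 0%R.
  rewrite preimage_nnfun0// integral0_eq => [|x _]; last by rewrite patchE in_set0.
  rewrite mule0 integral0_eq// => x _.
  by rewrite indicE in_set0 mulr0 mul0e.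
under eq_integral do rewrite patchedE.
rewrite -ge0_integralZl//.
- by apply: eq_integral => x _; rewrite -!EFinM mulrA.
- by apply/measurable_EFinP; exact: measurable_funM.
- by move=> x _; rewrite lee_fin mulr_ge0.
Qed.

End density_integral.

Section independent_pair.
Local Open Scope classical_set_scope.
Local Open Scope ereal_scope.
Context d (T : measurableType d) {R : realType} (P : probability T R).

(** The event [E] carries the remaining variables along, which makes the
    grouping of independent variables provable by induction. *)
Lemma joint_law (X Z : {RV P >-> R}) (E : set T) : measurable E ->
    (forall A B : set R, measurable A -> measurable B ->
      P (X @^-1` A `&` Z @^-1` B `&` E) = P (X @^-1` A) * (P (Z @^-1` B) * P E)) ->
  forall D : set (R * R), measurable D ->
    P ([set t | D (X t, Z t)] `&` E) =
    (distribution P X \x distribution P Z) D * P E.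
Proof.
move=> mE XZE D mD.
have mXZ : measurable_fun [set: T] (fun t => (X t, Z t)).
  exact: measurable_fun_pair.
have PE0 : (0 <= fine (P E))%R by rewrite fine_ge0.
pose k : {nonneg R} := NngNum PE0.
have PEfin : P E \is a fin_num by exact: fin_num_measure.
have kE : k%:num%:E = P E by rewrite /= fineK.
pose m' := measure_function_pushforward__canonical__measure_function_Measure
  (mrestr P mE) mXZ.
have -> : P ([set t | D (X t, Z t)] `&` E) = m' D by [].
rewrite -(@product_measure_unique _ _ _ _ _ (distribution P X)
  (mscale k (distribution P Z)) m')//.
  rewrite /product_measure1/=.
  rewrite -ge0_integralZr//.
    by apply: eq_integral => x _; rewrite /mscale/= muleC fineK.
  exact: measurable_fun_xsection.
move=> A B mA mB.
rewrite /mscale.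
have -> : m' (A `*` B) = P (X @^-1` A `&` Z @^-1` B `&` E) by [].
by rewrite XZE// [X in _ = _ * X]muleC kE.
Qed.

Lemma integral_independent_sum (X Z S : {RV P >-> R}) (a : R) (h : R -> \bar R) :
    (forall A B : set R, measurable A -> measurable B ->
      P (X @^-1` A `&` Z @^-1` B) = P (X @^-1` A) * P (Z @^-1` B)) ->
    (forall t, S t = (X t + a * Z t)%R) ->
    measurable_fun [set: R] h -> (forall x, 0 <= h x) ->
  \int[P]_t h (S t) =
  \int[P]_t \int[distribution P Z]_y h (X t + a * y)%R.
Proof.
move=> XZ SE mh h0.
have mXZ : measurable_fun [set: T] (fun t => (X t, Z t)).
  exact: measurable_fun_pair.
pose g (z : R * R) := h (z.1 + a * z.2)%R.
have mg : measurable_fun [set: R * R] g.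
  by apply: measurableT_comp => //; apply: measurable_funD => //; exact: measurable_funM.
have gXZ : {in [set: R * R], forall z, 0 <= g z} by move=> z _; exact: h0.
have gE := ge0_integral_pushforward mXZ P measurableT mg gXZ.
transitivity (\int[P]_(t in (fun t => (X t, Z t)) @^-1` setT) g (X t, Z t)).
  by apply: eq_integral => t _; rewrite /g/= SE.
rewrite -[LHS]gE.
transitivity (\int[distribution P X \x distribution P Z]_z g z).
  apply: eq_measure_integral => D mD _ /=.
  have := joint_law (X := X) (Z := Z) measurableT _ mD.
  rewrite setIT probability_setT mule1; apply => A B mA mB.
  by rewrite setIT mule1 XZ.
rewrite (fubini_tonelli1 g mg); last by move=> z; exact: h0.
rewrite ge0_integral_distribution//.
- apply: (@measurable_fun_fubini_tonelli_F _ _ _ _ _ (distribution P Z) g mg).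
  by move=> z; exact: h0.
- by move=> x; apply: integral_ge0 => y _; exact: h0.
Qed.

End independent_pair.

Section partial_sums.
Local Open Scope classical_set_scope.
Context d (T : measurableType d) {R : realType} (P : probability T R) (n : nat).
Variables (Y : 'I_n -> {RV P >-> R}) (a : 'I_n -> R).

Definition partial_sum (k : nat) (t : T) : R :=
  \sum_(i < n | (i < k)%N) a i * Y i t.

Let measurable_partial_sum k : measurable_fun [set: T] (partial_sum k).
Proof.
rewrite (_ : partial_sum k =
    fun t => \sum_(i < n) (if (i < k)%N then a i * Y i t else 0)).
  by apply: measurable_sum => i; case: (_ < k)%N => //; exact: measurable_funM.
by apply/funext => t; rewrite /partial_sum big_mkcond.
Qed.

HB.instance Definition _ k :=
  isMeasurableFun.Build _ _ _ _ (partial_sum k) (measurable_partial_sum k).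

Lemma partial_sumS (k : 'I_n) t :
  partial_sum k.+1 t = partial_sum k t + a k * Y k t.
Proof.
rewrite /partial_sum (bigD1 k)//= addrC; congr (_ + _).
by apply: eq_bigl => i; rewrite ltnS ltn_neqAle andbC.
Qed.

Lemma partial_sum_all t : partial_sum n t = \sum_(i < n) a i * Y i t.
Proof. by apply: eq_bigl => i; rewrite ltn_ord. Qed.

Hypothesis Yind : mutually_independent Y.

Let later (k : nat) : {set 'I_n} := [set i : 'I_n | (k <= i)%N]%SET.

Let later_event k (A : 'I_n -> set R) :=
  \bigcap_(i in [set` later k]) (Y i @^-1` A i).

Let later_event_measurable k A : (forall i, measurable (A i)) ->
  measurable (later_event k A).
Proof.
move=> mA; apply: fin_bigcap_measurable; first exact: finite_finset.
by move=> i _; exact: measurable_funPTI.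
Qed.

Let laterS (k : 'I_n) : later k = (k |: later k.+1)%SET.
Proof.
by apply/setP => i; rewrite !inE leq_eqVlt (inj_eq val_inj) eq_sym.
Qed.

Let later_eventS (k : 'I_n) A :
  later_event k A = Y k @^-1` A k `&` later_event k.+1 A.
Proof.
rewrite /later_event; apply/seteqP; split => [t H|t [H1 H2] i /=].
  split; first by apply: (H k); rewrite /= inE.
  by move=> i /=; rewrite inE => ki; apply: (H i); rewrite /= inE ltnW.
rewrite inE leq_eqVlt => /predU1P[ki|ki].
  by have <- : k = i by exact: val_inj.
by apply: H2; rewrite /= inE.
Qed.

Let prob_later_eventS (k : 'I_n) A : (forall i, measurable (A i)) ->
  P (later_event k A) = (P (Y k @^-1` A k) * P (later_event k.+1 A))%E.
Proof.
move=> mA; rewrite /later_event !Yind// laterS big_setU1//= inE.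
by rewrite ltnn.
Qed.

Let grouped k := forall (B : set R) (A : 'I_n -> set R),
  measurable B -> (forall i, measurable (A i)) ->
  P (partial_sum k @^-1` B `&` later_event k A) =
  (P (partial_sum k @^-1` B) * P (later_event k A))%E.

Let grouped_joint (k : 'I_n) A A1 B1 : grouped k ->
    (forall i, measurable (A i)) -> measurable A1 -> measurable B1 ->
  P (partial_sum k @^-1` A1 `&` Y k @^-1` B1 `&` later_event k.+1 A) =
  (P (partial_sum k @^-1` A1) * (P (Y k @^-1` B1) * P (later_event k.+1 A)))%E.
Proof.
move=> gk mA mA1 mB1; pose A' i := if i == k then B1 else A i.
have mA' i : measurable (A' i) by rewrite /A'; case: ifP.
have AA' : later_event k.+1 A = later_event k.+1 A'.
  apply: eq_bigcapr => i /=; rewrite inE => ki.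
  by rewrite /A' -val_eqE/= gtn_eqF.
have := gk A1 A' mA1 mA'.
rewrite prob_later_eventS// later_eventS.
by rewrite AA' /A' eqxx setIA.
Qed.

Let later_eventT k : later_event k (fun=> setT) = setT.
Proof. by apply/seteqP; split. Qed.

Let grouped_joint2 (k : 'I_n) A1 B1 : grouped k ->
    measurable A1 -> measurable B1 ->
  P (partial_sum k @^-1` A1 `&` Y k @^-1` B1) =
  (P (partial_sum k @^-1` A1) * P (Y k @^-1` B1))%E.
Proof.
move=> gk mA1 mB1; have := grouped_joint gk (fun=> measurableT) mA1 mB1.
by rewrite later_eventT setIT probability_setT mule1.
Qed.

(** The partial sum [k.+1] is a function of the partial sum [k] and of [Y k];
    [joint_law] gives the law of that pair restricted to an event that depends
    on the later variables only. *)
Let groupedP (k : nat) : (k <= n)%N -> grouped k.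
Proof.
elim: k => [_ B A mB mA|k ih kn B A mB mA].
  have s0 : partial_sum 0 = cst 0 by apply/funext => t; exact: big_pred0.
  rewrite s0 preimage_cst; case: ifP => _.
    by rewrite setTI probability_setT mul1e.
  by rewrite set0I measure0 mul0e.
pose k' := Ordinal kn.
have {ih} gk : grouped k' := ih (ltnW kn).
have mE := later_event_measurable k.+1 mA.
pose D := [set z : R * R | B (z.1 + a k' * z.2)].
have mD : measurable D.
  rewrite -[D]setTI; suff : measurable_fun [set: R * R] (fun z : R * R => z.1 + a k' * z.2) by exact.
  by apply: measurable_funD => //; exact: measurable_funM.
have jl := joint_law (X := partial_sum k') (Z := Y k') mE
  (fun A1 B1 => grouped_joint gk mA) mD.
have jlT := joint_law (X := partial_sum k') (Z := Y k') measurableT _ mD.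
have SD : [set t | D (partial_sum k' t, Y k' t)] = partial_sum k.+1 @^-1` B.
  by apply/funext => t; rewrite /D/= -[k.+1]/(k'.+1) partial_sumS.
rewrite SD in jl; rewrite jl; congr (_ * _)%E.
move: jlT; rewrite SD setIT probability_setT mule1 => -> // A1 B1 mA1 mB1.
by rewrite setIT mule1 grouped_joint2.
Qed.

Lemma integral_partial_sumS (k : 'I_n) (h : R -> \bar R) :
    measurable_fun [set: R] h -> (forall x, (0 <= h x)%E) ->
  (\int[P]_t h (partial_sum k.+1 t) =
   \int[P]_t \int[distribution P (Y k)]_y h (partial_sum k t + a k * y)%R)%E.
Proof.
move=> mh h0.
apply: (@integral_independent_sum _ _ _ _ (partial_sum k) (Y k) (partial_sum k.+1)) => //.
  by move=> A B mA mB; apply: grouped_joint2 => //; apply: groupedP; exact: ltnW.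
by move=> t; exact: partial_sumS.
Qed.

Variable f : R -> R.
Hypotheses (pf : peaked f) (f1 : (\int[lebesgue_measure]_y (f y)%:E = 1)%E).
Hypothesis Yf : forall i (A : set R), measurable A ->
  distribution P (Y i) A = (\int[lebesgue_measure]_(x in A) (f x)%:E)%E.

Lemma integral_law (i : 'I_n) (h : R -> \bar R) :
    measurable_fun [set: R] h -> (forall x, (0 <= h x)%E) ->
  (\int[distribution P (Y i)]_y h y = \int[lebesgue_measure]_y (h y * (f y)%:E))%E.
Proof.
move=> mh h0.
exact: (ge0_integral_density (peaked_measurable pf) (peaked_ge0 pf) (@Yf i)).
Qed.

(** Integrating out the last variable replaces [h] by its average; the induction
    hypothesis applies to that average, and [average_average] merges the two
    averages that remain. *)
Lemma partial_sum_extremal s (k : nat) (h : R -> R) : (k <= n)%N ->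
    test_function s h ->
  elee s (average f (Num.sqrt (\sum_(i < n | (i < k)%N) a i ^+ 2)) h 0)%:E
         (\int[P]_t (h (partial_sum k t))%:E)%E.
Proof.
elim: k h => [|k ih] h kn th.
  rewrite big_pred0// sqrtr0 (average0 pf f1 th).
  have -> : (\int[P]_t (h (partial_sum 0 t))%:E = (h 0)%:E)%E.
    under eq_integral do rewrite /partial_sum big_pred0//.
    by rewrite -[RHS]mule1 -(@probability_setT _ _ _ P); exact: integral_cst.
  by rewrite /elee; case: s th => th.
pose k' := Ordinal kn.
have tah := test_function_average pf th (a k').
have {ih} := ih _ (ltnW kn) tah.
have mh := test_measurable th; have h0 := test_ge0 th.
have mhE : measurable_fun [set: R] (EFin \o h) by exact/measurable_EFinP.
have h0E x : (0 <= (EFin \o h) x)%E by rewrite lee_fin.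
have -> := integral_partial_sumS k' mhE h0E.
have -> : (\int[P]_t \int[distribution P (Y k')]_y (EFin \o h) (partial_sum k' t + a k' * y)%R =
    \int[P]_t (average f (a k') h (partial_sum k t))%:E)%E.
  apply: eq_integral => t _; rewrite (averageE pf th) integral_law//.
  apply/measurable_EFinP; apply: measurableT_comp => //.
  by apply: measurable_funD => //; exact: measurable_funM.
set r2 := \sum_(i < n | (i < k)%N) a i ^+ 2.
have r20 : 0 <= r2 by apply: sumr_ge0 => i _; exact: sqr_ge0.
have -> : \sum_(i < n | (i < k'.+1)%N) a i ^+ 2 = Num.sqrt r2 ^+ 2 + a k' ^+ 2.
  rewrite sqr_sqrtr// (bigD1 k')//= addrC; congr (_ + _).
  by apply: eq_bigl => i; rewrite ltnS ltn_neqAle andbC.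
have := average_average pf f1 (a k') (sqrtr_ge0 r2) th.
rewrite /elee /dle; case: (s) => A B.
  by apply: le_trans B; rewrite lee_fin.
by apply: le_trans B _; rewrite lee_fin.
Qed.

End partial_sums.

(** * The densities and the powers *)

Section exp_weight_peaked.
Context {R : realType}.
Notation mu := (@lebesgue_measure R).

Lemma peaked_scale (c : R) (g : R -> R) : 0 <= c -> peaked g ->
  peaked (fun x => c * g x).
Proof.
move=> c0 [mg g0 gN gU gS gE]; split.
- exact: measurable_funM.
- by move=> x; rewrite mulr_ge0.
- by move=> x; rewrite gN.
- by move=> x y xy; rewrite ler_wpM2l// gU.
- move=> y1 y2 z1 z2 e d1 d2; rewrite mulrACA [leRHS]mulrACA.
  by rewrite ler_wpM2l ?mulr_ge0//; exact: gS e d1 d2.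
- move=> a; under eq_integral do rewrite mulrCA EFinM.
  rewrite ge0_integralZl//.
  + by rewrite lte_mul_pinfty// gE.
  + apply/measurable_EFinP; apply: measurable_funM => //.
    by apply: measurableT_comp => //; apply: measurable_funM => //; exact: measurableT_comp.
  + by move=> y _; rewrite lee_fin mulr_ge0// expR_ge0.
Qed.

Lemma peaked_uniform : peaked (uniform_pdf (-1) 1 : R -> R).
Proof.
have uE x : uniform_pdf (-1) 1 x = if `|x| <= 1 then (1 - -1)^-1 else 0 :> R.
  by rewrite /uniform_pdf ler_norml.
have u0 x : 0 <= uniform_pdf (-1) 1 x :> R by rewrite uniform_pdf_ge0//; lra.
have half0 : 0 <= (1 - -1)^-1 :> R by rewrite invr_ge0; lra.
split => //.
- exact: measurable_uniform_pdf.
- by move=> x; rewrite !uE normrN.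
- move=> x y xy; rewrite uE; case: ifP => // y1.
  by rewrite uE (le_trans xy y1).
- move=> y1 y2 z1 z2 _ d1 d2; rewrite (uE y1); case: ifP => y11; last first.
    by rewrite mul0r mulr_ge0.
  rewrite (uE z1) (le_trans d1 y11) (uE z2) (le_trans d2 y11).
  by rewrite ler_wpM2l// uE; case: ifP.
- move=> a; apply: (@le_lt_trans _ _
    (\int[mu]_y ((expR `|a|)%:E * (uniform_pdf (-1) 1 y)%:E))%E).
    apply: ge0_le_integral => //.
    + by move=> y _; rewrite lee_fin mulr_ge0// expR_ge0.
    + apply/measurable_EFinP; apply: measurable_funM; last exact: measurable_uniform_pdf.
      by apply: measurableT_comp => //; apply: measurable_funM => //; exact: measurableT_comp.
    + apply/measurable_EFinP; apply: measurable_funM => //; exact: measurable_uniform_pdf.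
    + move=> y _; rewrite -EFinM lee_fin uE; case: ifP => [y1|_]; last by rewrite !mulr0.
      rewrite ler_wpM2r//.
      rewrite ler_expR (le_trans (ler_norm _))// normrM normr_id.
      by rewrite ler_piMr.
  rewrite ge0_integralZl ?lee_fin ?expR_ge0//.
  + rewrite (@integral_uniform_pdf1 _ (-1) 1 setT) ?mule1 ?ltry//; lra.
  + apply/measurable_EFinP; exact: measurable_uniform_pdf.
  + by move=> y _; rewrite lee_fin.
Qed.

Lemma normpow_bounded (p a : R) : 0 <= p ->
  exists B, forall x : R, `|x| <= a -> `| `|x| `^ p| <= B.
Proof.
move=> p0; exists (`|a| `^ p) => x xa; rewrite ger0_norm ?powR_ge0//.
by rewrite ge0_ler_powR ?nnegrE// (le_trans xa)// ler_norm.
Qed.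

(** The product condition is [square_schur] for [|x|^r], which is
    [mixed_monotone] as [r >= 2]. Moments: [|y|^r >= y^2 - 1] and
    [a |y| <= (a^2 + y^2) / 2] leave a Gaussian factor. *)
Lemma peaked_exp (r : R) : 2 <= r -> peaked (fun x : R => expR (- (`|x| `^ r))).
Proof.
move=> r2; have r0 : 0 <= r by lra.
have mp : measurable_fun [set: R] (fun x : R => `|x| `^ r).
  by apply: (measurableT_comp (measurable_powR r)) => //; exact: measurableT_comp.
have mE : measurable_fun [set: R] (fun x : R => expR (- (`|x| `^ r))).
  by apply: measurableT_comp => //; exact: measurableT_comp.
split.
- exact: mE.
- by move=> x; exact: expR_ge0.
- by move=> x; rewrite normrN.
- by move=> x y xy; rewrite ler_expR lerN2 ge0_ler_powR.
- move=> y1 y2 z1 z2 e d1 d2; rewrite -!expRD ler_expR -!opprD lerN2.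
  apply: (@square_schur _ (fun x : R => `|x| `^ r)) e d1 d2.
  + by move=> x; rewrite normrN.
  + by move=> a; exact: normpow_bounded.
  + exact: (@mixed_monotone_normpow _ true).
- move=> a; pose k := normal_peak (1 : R).
  have k0 : 0 < k by rewrite normal_peak_gt0.
  pose K := expR (1 + a ^+ 2 / 2) / k.
  have K0 : 0 <= K by rewrite divr_ge0 ?expR_ge0// ltW.
  apply: (@le_lt_trans _ _ (\int[mu]_y (K%:E * (normal_pdf 0 1 y)%:E))%E).
    apply: ge0_le_integral => //.
    + apply/measurable_EFinP; apply: measurable_funM => //.
      by apply: measurableT_comp => //; apply: measurable_funM => //; exact: measurableT_comp.
    + apply/measurable_EFinP; apply: measurable_funM => //; exact: measurable_normal_pdf.
    + move=> y _; rewrite -EFinM lee_fin normal_pdfE ?oner_neq0//.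
      rewrite -/k /K mulrA divfK ?gt_eqF// /normal_fun -!expRD ler_expR.
      rewrite subr0 expr1n.
      have : y ^+ 2 - 1 <= `|y| `^ r.
        rewrite -[y ^+ 2]real_normK ?num_real//.
        have [y1|y1] := leP 1 `|y|.
          have := ler_powR y1 r2; rewrite powR_mulrn//; lra.
        have : `|y| ^+ 2 <= 1 by rewrite expr_le1// ltW.
        by have := powR_ge0 `|y| r; lra.
      have := sqr_ge0 (a - `|y|); rewrite sqrrB real_normK ?num_real//.
      lra.
  rewrite ge0_integralZl//.
  + by rewrite integral_normal_pdf mule1 ltry.
  + apply/measurable_EFinP; exact: measurable_normal_pdf.
  + by move=> y _; rewrite lee_fin normal_pdf_ge0.
Qed.

Lemma peaked_exp_weight (q : \bar R) : (2%:E <= q)%E -> peaked (exp_weight q).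
Proof.
case: q => [r| |//].
  by rewrite lee_fin; exact: peaked_exp.
by move=> _; exact: peaked_uniform.
Qed.

(** The growth bound is [ln t <= t] at [t = |x| / p]. *)
Lemma test_function_normpow s (p : R) : (if s then 2 <= p else 1 <= p <= 2) ->
  test_function s (fun x : R => `|x| `^ p).
Proof.
move=> ps; have p0 : 0 < p by case: s ps; lra.
split.
- by apply: (measurableT_comp (measurable_powR p)) => //; exact: measurableT_comp.
- by move=> x; exact: powR_ge0.
- by move=> x; rewrite normrN.
- exists (expR (p * ln p)) => x; have [->|x0] := eqVneq x 0.
    by rewrite normr0 powR0 ?gt_eqF// mulr_ge0// expR_ge0.
  have nx : 0 < `|x| by rewrite normr_gt0.
  rewrite /powR gt_eqF// -expRD ler_expR.
  have xp : 0 < `|x| / p by rewrite divr_gt0.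
  have := ltW (ln_sublinear xp).
  rewrite ln_div ?posrE// ler_pdivlMr// mulrC mulrBr; lra.
- exact: mixed_monotone_normpow.
Qed.

End exp_weight_peaked.

(** * Comparison of moments *)

Section same_law.
Local Open Scope ereal_scope.
Context d (T : measurableType d) {R : realType} (P : probability T R).

(** The normalizing constants all equal the inverse of the total mass of
    [g]. *)
Lemma common_density (I : Type) (i0 : I) (Y : I -> {RV P >-> R}) (g : R -> R) :
    measurable_fun [set: R] g -> (forall x, 0 <= g x)%R ->
    (forall i, has_density_proportional_to (Y i) g) ->
  exists2 c : R, (0 < c)%R & forall i (A : set R), measurable A ->
    distribution P (Y i) A = \int[lebesgue_measure]_(x in A) (c * g x)%:E.
Proof.
move=> mg g0 Yg.
have mass (c : R) i : (0 < c)%R -> (forall A : set R, measurable A ->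
    distribution P (Y i) A = \int[lebesgue_measure]_(x in A) (c * g x)%:E) ->
  c%:E * \int[lebesgue_measure]_x (g x)%:E = 1.
  move=> c0 cE; rewrite -ge0_integralZl//.
  - by have := cE _ measurableT; rewrite probability_setT.
  - exact/measurable_EFinP.
  - by move=> x _; rewrite lee_fin.
  - by rewrite lee_fin ltW.
have [c c0 cE] := Yg i0; exists c => // i; have [b b0 bE] := Yg i.
suff -> : c = b by [].
have := mass _ _ c0 cE; have := mass _ _ b0 bE.
case: (\int[lebesgue_measure]_x (g x)%:E) => [I1||].
- rewrite -!EFinM => -[bI] [cI].
  have I0 : (I1 != 0)%R.
    by apply/eqP => I0; move: bI; rewrite I0 mulr0 => /esym/eqP; rewrite oner_eq0.
  by apply: (mulIf I0); rewrite bI cI.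
- by rewrite gt0_muley ?lte_fin.
- by rewrite gt0_muleNy ?lte_fin.
Qed.

Lemma Lnorm_EFin (p : R) (X : T -> R) :
  'N[P]_p%:E[EFin \o X] = (\int[P]_t (`|X t| `^ p)%:E) `^ p^-1.
Proof. by rewrite unlock. Qed.

Lemma Lnorm_density_neq0 (X : {RV P >-> R}) (f : R -> R) (p : \bar R) :
    (forall A : set R, measurable A ->
      distribution P X A = \int[lebesgue_measure]_(x in A) (f x)%:E) ->
    0 < p ->
  'N[P]_p[EFin \o X] != 0.
Proof.
move=> Xf p0; apply/eqP => N0.
have mX : measurable_fun [set: T] (EFin \o X) by exact/measurable_EFinP.
have [N [mN PN sub]] := Lnorm_eq0_eq0 mX p0 N0.
have mX0 : measurable (X @^-1` [set 0%R])%classic by exact: measurable_funPTI.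
have : P (~` (X @^-1` [set 0%R]))%classic = 0.
  apply/eqP; rewrite eq_le measure_ge0 andbT -PN.
  apply: le_measure; rewrite ?inE//; first exact: measurableC.
  by move=> t /= Xt; apply: sub => /= /(_ I) [].
rewrite probability_setC//.
have -> : P (X @^-1` [set 0%R])%classic = 0.
  by rewrite -[LHS]/(distribution P X [set 0%R]%classic) Xf// integral_set1.
by rewrite sube0 => /eqP; rewrite eqe oner_eq0.
Qed.

End same_law.


Theorem theorem1 (R : realType) (q : \bar R) (hq : (2%:E <= q)%E) (n : nat)
    (d : measure_display) (T : measurableType d) (P : probability T R)
    (Y : 'I_n.+1 -> {RV P >-> R})
    (Yind : mutually_independent Y)
    (Ydens : forall i, has_density_proportional_to (Y i) (exp_weight q)) :
  let S (a : 'I_n.+1 -> R) (t : T) := \sum_(i < n.+1) a i * Y i t in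
  let unit_vec (a : 'I_n.+1 -> R) := \sum_(i < n.+1) a i ^+ 2 = 1 in
  [/\ forall (a : 'I_n.+1 -> R) (p : R), unit_vec a -> 2 <= p ->
        ('N[P]_p%:E[EFin \o Y ord0] <= 'N[P]_p%:E[EFin \o S a])%E,
      forall (a : 'I_n.+1 -> R) (p : R), unit_vec a -> 1 <= p -> p <= 2 ->
        ('N[P]_p%:E[EFin \o S a] <= 'N[P]_p%:E[EFin \o Y ord0])%E,
      forall p c : R, 2 <= p ->
        (forall a : 'I_n.+1 -> R, unit_vec a ->
          (c%:E * 'N[P]_p%:E[EFin \o Y ord0] <= 'N[P]_p%:E[EFin \o S a])%E) ->
        c <= 1
    & forall p c : R, 1 <= p -> p <= 2 ->
        (forall a : 'I_n.+1 -> R, unit_vec a ->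
          ('N[P]_p%:E[EFin \o S a] <= c%:E * 'N[P]_p%:E[EFin \o Y ord0])%E) ->
        1 <= c].
Proof.
move=> S unit_vec.
have pg := peaked_exp_weight hq.
have [c0 c0_gt0 Ylaw] := common_density ord0 (peaked_measurable pg) (peaked_ge0 pg) Ydens.
pose f x := c0 * exp_weight q x.
have pf : peaked f := peaked_scale (ltW c0_gt0) pg.
have f1 : (\int[lebesgue_measure]_y (f y)%:E = 1)%E.
  by rewrite -(Ylaw ord0 setT measurableT) probability_setT.
have Y0E s p : (if s then 2 <= p else 1 <= p <= 2) ->
    (\int[P]_t (`|Y ord0 t| `^ p)%:E = (average f 1 (fun x => `|x| `^ p) 0)%:E)%E.
  move=> /test_function_normpow th; rewrite (averageE pf th).
  have mh := test_measurable th.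
  have mhE : measurable_fun [set: R] (fun x : R => (`|x| `^ p)%:E).
    exact/measurable_EFinP.
  have := integral_law pf Ylaw ord0 mhE (fun x => powR_ge0 _ _).
  rewrite ge0_integral_distribution// => ->; apply: eq_integral => y _.
  by rewrite add0r mul1r EFinM.
have main s a p : (if s then 2 <= p else 1 <= p <= 2) -> unit_vec a ->
    elee s (\int[P]_t (`|Y ord0 t| `^ p)%:E) (\int[P]_t (`|S a t| `^ p)%:E).
  move=> ps au; rewrite (Y0E s)//.
  have := partial_sum_extremal a Yind pf f1 Ylaw (leqnn _) (test_function_normpow ps).
  under eq_bigl do rewrite ltn_ord.
  rewrite au sqrtr1.
  by under eq_integral do rewrite partial_sum_all.
have int0 (X : T -> R) p : (0 <= \int[P]_t (`|X t| `^ p)%:E)%E.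
  by apply: integral_ge0 => t _; rewrite lee_fin powR_ge0.
have root (x y : \bar R) p : 1 <= p -> (0 <= x -> 0 <= y -> x <= y ->
    x `^ p^-1 <= y `^ p^-1)%E.
  move=> p1 x0 y0 xy; apply: gt0_ler_poweR => //.
  - by rewrite invr_ge0; lra.
  - by rewrite in_itv/= x0 leey.
  - by rewrite in_itv/= y0 leey.
pose e0 (i : 'I_n.+1) : R := (i == ord0)%:R.
have e0_unit : unit_vec e0.
  rewrite /unit_vec (bigD1 ord0)//= big1 ?addr0; first by rewrite /e0 eqxx expr1n.
  by move=> i /negbTE i0; rewrite /e0 i0 expr0n.
have Se0 : S e0 = Y ord0.
  apply/funext => t; rewrite /S (bigD1 ord0)//= big1 ?addr0.
    by rewrite /e0 eqxx mul1r.
  by move=> i /negbTE i0; rewrite /e0 i0 mul0r.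
have norm_pos p : 1 <= p ->
    exists2 N : R, 0 < N & ('N[P]_p%:E[EFin \o Y ord0] = N%:E)%E.
  move=> p1.
  have [s ps] : exists s : bool, if s then 2 <= p else 1 <= p <= 2.
    by have [p2|p2] := leP 2 p; [exists true|exists false; lra].
  pose N := average f 1 (fun x => `|x| `^ p) 0 `^ p^-1.
  have NE : ('N[P]_p%:E[EFin \o Y ord0] = N%:E)%E.
    by rewrite Lnorm_EFin (Y0E s)// poweR_EFin.
  exists N => //; rewrite lt_def powR_ge0 andbT; apply/eqP => N0.
  have p0 : (0 < p%:E)%E by rewrite lte_fin; lra.
  by have := Lnorm_density_neq0 (Ylaw ord0) p0; rewrite NE N0 eqxx.
split.
- move=> a p au p2; rewrite !Lnorm_EFin; apply: root => //; first by lra.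
  exact: (main true).
- move=> a p au p1 p2; rewrite !Lnorm_EFin; apply: root => //.
  by apply: (main false); rewrite ?p1.
- move=> p c p2 /(_ _ e0_unit); rewrite Se0.
  have [N N0 ->] : exists2 N : R, 0 < N & ('N[P]_p%:E[EFin \o Y ord0] = N%:E)%E.
    by apply: norm_pos; lra.
  by rewrite -EFinM lee_fin -[leRHS]mul1r ler_pM2r.
- move=> p c p1 p2 /(_ _ e0_unit); rewrite Se0.
  have [N N0 ->] := norm_pos p p1.
  by rewrite -EFinM lee_fin -[leLHS]mul1r ler_pM2r.
Qed.
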